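(* For all integers $m\ge 1$ and $n\ge 2$, $\chi_{lt}(mC_6+P_3)=4$ and $\chi_{lt}(mC_6+nP_3)=2n+1$.
   Context: $G+H$ is the disjoint union of $G$ and $H$, $mG$ is the disjoint union of $m$ copies of $G$, $P_n$ is the path on $n$ vertices and $C_n$ is the cycle on $n$ vertices. For a finite simple graph $G=(V,E)$ of order $p$ and size $q$, a local total antimagic labeling is a bijection $f:V\cup E\to\{1,\dots,p+q\}$ such that, with weights $w_f(u)=\sum f(e)$ over all edges $e$ incident to $u$ for $u\in V$ (the label of $u$ itself is not included) and $w_f(uv)=f(u)+f(v)$ for $uv\in E$, one has: adjacent vertices have distinct weights, adjacent edges have distinct weights, and every vertex has a weight distinct from that of each of its incident edges. $\chi_{lt}(G)$ is the minimum, over all local total antimagic labelings $f$ of $G$, of the number of distinct values among all the vertex and edge weights. *)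

(* Defs.v *)
From mathcomp Require Import all_boot.

Set Implicit Arguments.
Unset Strict Implicit.
Unset Printing Implicit Defensive.

Record sgraph := SGraph {
  vertex :> finType;
  adj : rel vertex;
  adj_sym : symmetric adj;
  adj_irrefl : irreflexive adj
}.

Definition is_edge (G : sgraph) (e : {set G}) : bool :=
  [exists u : G, exists v : G, adj u v && (e == [set u; v])].

Definition edge (G : sgraph) : finType := {e : {set G} | is_edge e}.

Section DisjointUnion.
Variables G H : sgraph.

Definition dunion_adj (x y : G + H) : bool :=
  match x, y with
  | inl u, inl v => adj u v
  | inr u, inr v => adj u v
  | _, _ => false
  end.

Lemma dunion_adj_sym : symmetric dunion_adj.
Proof. by move=> [u|u] [v|v] //=; apply: adj_sym. Qed.

Lemma dunion_adj_irrefl : irreflexive dunion_adj.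
Proof. by move=> [u|u] /=; apply: adj_irrefl. Qed.

Definition dunion : sgraph := SGraph dunion_adj_sym dunion_adj_irrefl.

End DisjointUnion.

Section Copies.
Variables (m : nat) (G : sgraph).

Definition copies_adj (x y : 'I_m * G) : bool :=
  (x.1 == y.1) && adj x.2 y.2.

Lemma copies_adj_sym : symmetric copies_adj.
Proof. by move=> x y; rewrite /copies_adj eq_sym adj_sym. Qed.

Lemma copies_adj_irrefl : irreflexive copies_adj.
Proof. by move=> x; rewrite /copies_adj adj_irrefl andbF. Qed.

Definition copies : sgraph := SGraph copies_adj_sym copies_adj_irrefl.

End Copies.

Section PathGraph.
Variable n : nat.

Definition path_adj (i j : 'I_n) : bool := (i.+1 == j) || (j.+1 == i).

Lemma path_adj_sym : symmetric path_adj.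
Proof. by move=> i j; rewrite /path_adj orbC. Qed.

Lemma path_adj_irrefl : irreflexive path_adj.
Proof. by move=> i; rewrite /path_adj orbb gtn_eqF. Qed.

Definition path_graph : sgraph := SGraph path_adj_sym path_adj_irrefl.

End PathGraph.

Section CycleGraph.
Variable n : nat.

(* [ordS] is the successor modulo [n].  This is the usual cycle for [n >= 3];
   the test [i != j] only matters for [n = 1]. *)
Definition cycle_adj (i j : 'I_n) : bool :=
  (i != j) && ((ordS i == j) || (ordS j == i)).

Lemma cycle_adj_sym : symmetric cycle_adj.
Proof. by move=> i j; rewrite /cycle_adj eq_sym orbC. Qed.

Lemma cycle_adj_irrefl : irreflexive cycle_adj.
Proof. by move=> i; rewrite /cycle_adj eqxx. Qed.

Definition cycle_graph : sgraph := SGraph cycle_adj_sym cycle_adj_irrefl.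

End CycleGraph.

Section Labeling.
Variable G : sgraph.

Definition labeling : Type := G + edge G -> 'I_(#|G| + #|edge G|).

Variable f : labeling.

(* Ordinals start at 0, labels at 1. *)
Definition label (x : G + edge G) : nat := (f x).+1.

Definition vweight (u : G) : nat := \sum_(e : edge G | u \in val e) label (inr e).

Definition eweight (e : edge G) : nat := \sum_(u in val e) label (inl u).

Definition weight (x : G + edge G) : nat :=
  match x with inl u => vweight u | inr e => eweight e end.

Record local_total_antimagic : Prop := LocalTotalAntimagic {
  lta_bij : bijective f;
  lta_vertices : forall u v : G, adj u v -> vweight u <> vweight v;
  lta_edges : forall e1 e2 : edge G,
    e1 <> e2 -> val e1 :&: val e2 != set0 -> eweight e1 <> eweight e2;
  lta_incident : forall (u : G) (e : edge G),
    u \in val e -> vweight u <> eweight e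
}.

Definition nb_weights : nat := size (undup (codom weight)).

End Labeling.

(* [chi_lt G k] states that the minimum defining the local total antimagic
   chromatic number of [G] exists and equals [k]: a graph (such as the path
   on two vertices) may have no local total antimagic labeling at all. *)
Definition chi_lt (G : sgraph) (k : nat) : Prop :=
  (exists2 f : labeling G, local_total_antimagic f & nb_weights f = k) /\
  (forall f : labeling G, local_total_antimagic f -> k <= nb_weights f).

(* Main.v *)
Require Import Defs.
From mathcomp Require Import all_boot zify.

(** Lower bounds.  The 2n pendant vertices carry as weights the labels of the 2n
    pendant edges, and the centre of the path that contains the largest of these
    labels has a larger weight: at least 2n+1 weights.  If n = 1 and only the
    three weights a, b, a+b occur, then the weights of a hexagon form a proper
    total colouring of C_6 in three colours, so some three consecutive vertices
    have weights {a, a+b, b} with a+b in the middle; the four edges involved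
    have label sum a + b, of which the two middle ones already account for a+b.

    Construction.  Put s = 4m+n+1, A = 8m+2n+2, B = 12m+5n.  The labels other
    than those of pendant edges are y, A-y, B-y for 0 < y < s.  The orbit t, s-t
    of y -> s-y supplies the six labels of the edges (or of the vertices) of a
    hexagon, with consecutive sums A, A+B-s, B, and the n middle values of y
    label the centres of the paths.  The remaining labels are exchanged by
    x -> A+B-s-x and are paired accordingly on the pendant edges, so that every
    centre also has weight A+B-s.  Since B is a pendant label, and A is one as
    soon as n >= 2, the only other weight is A+B-s (and A if n = 1). *)

Set Implicit Arguments.
Unset Strict Implicit.
Unset Printing Implicit Defensive.

(** * Labelings of a graph with explicitly listed edges *)

(** An edge of [G] is a set packed with a proof, which is awkward to sum over. Here the edges are
    indexed, with an arbitrary orientation, and [inc] lists the edges at a vertex, so that vertex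
    weights become explicit sums. *)
Record presentation (G : sgraph) := Presentation {
  pvertex : finType;
  pedge : finType;
  pvert : pvertex -> G;
  src : pedge -> pvertex;
  tgt : pedge -> pvertex;
  inc : pvertex -> seq pedge;
  pvert_bij : bijective pvert;
  adj_src_tgt : forall i, adj (pvert (src i)) (pvert (tgt i));
  adj_pedge : forall u v, adj (pvert u) (pvert v) ->
    exists i, (src i = u /\ tgt i = v) \/ (src i = v /\ tgt i = u);
  pedge_inj : forall i j, (src i = src j /\ tgt i = tgt j) \/
    (src i = tgt j /\ tgt i = src j) -> i = j;
  inc_uniq : forall v, uniq (inc v);
  mem_inc : forall v i, (i \in inc v) = (v == src i) || (v == tgt i)
}.

Section Presentation.
Variables (G : sgraph) (p : presentation G).
Implicit Types (u v : pvertex p) (i j : pedge p) (f : labeling G)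
  (g : pvertex p + pedge p -> nat).

Definition pweight g (x : pvertex p + pedge p) : nat :=
  match x with
  | inl v => \sum_(i <- inc v) g (inr i)
  | inr i => g (inl (src i)) + g (inl (tgt i))
  end.

Definition nb_pweights g : nat := size (undup (codom (pweight g))).

Record antimagic g : Prop := Antimagic {
  antimagic_inj : injective g;
  antimagic_range : forall x, 0 < g x <= #|pvertex p| + #|pedge p|;
  antimagic_vertices : forall i,
    pweight g (inl (src i)) <> pweight g (inl (tgt i));
  antimagic_edges : forall v i j, i \in inc v -> j \in inc v -> i <> j ->
    pweight g (inr i) <> pweight g (inr j);
  antimagic_incident : forall v i, i \in inc v ->
    pweight g (inl v) <> pweight g (inr i)
}.

Lemma pedge_is_edge i : is_edge [set pvert (src i); pvert (tgt i)].
Proof.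
apply/existsP; exists (pvert (src i)); apply/existsP; exists (pvert (tgt i)).
by rewrite adj_src_tgt eqxx.
Qed.

Definition edge_of i : edge G := Sub _ (pedge_is_edge i).

Definition elt_of (x : pvertex p + pedge p) : G + edge G :=
  match x with inl v => inl (pvert v) | inr i => inr (edge_of i) end.

Lemma pvert_inj : injective (@pvert G p).
Proof. exact: bij_inj (pvert_bij p). Qed.

Lemma src_neq_tgt i : src i != tgt i.
Proof.
by apply/eqP=> e; have := adj_src_tgt i; rewrite e adj_irrefl.
Qed.

Lemma in_edge_of v i : (pvert v \in val (edge_of i)) = (i \in inc v).
Proof. by rewrite mem_inc /= !inE !(inj_eq pvert_inj). Qed.

(** Equal sets have the same members, so the ends agree up to a swap; [src_neq_tgt] excludes the
    mixed cases. *)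
Lemma edge_of_inj : injective edge_of.
Proof.
move=> i j e; apply: pedge_inj.
have E x : (x == src i) || (x == tgt i) = (x == src j) || (x == tgt j).
  by rewrite -!mem_inc -!in_edge_of e.
have := src_neq_tgt i; have := src_neq_tgt j.
have := E (src i); have := E (tgt i); rewrite !eqxx orbT /= => /esym.
case/orP=> /eqP-> /esym /orP[] /eqP->; rewrite ?eqxx //; tauto.
Qed.

Lemma edge_of_surj e : exists i, edge_of i = e.
Proof.
have [h hK Kh] := pvert_bij p.
case: e => e He; have /existsP[u /existsP[v /andP[uv /eqP De]]] := He.
have: adj (pvert (h u)) (pvert (h v)) by rewrite !Kh.
case/adj_pedge=> i Di; exists i; apply: val_inj => /=.
by case: Di => -[-> ->]; rewrite !Kh De // setUC.
Qed.

Lemma elt_of_inj : injective elt_of.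
Proof.
move=> [u|i] [v|j] //= e; first by rewrite (pvert_inj (inl_inj e)).
by rewrite (edge_of_inj (inr_inj e)).
Qed.

Lemma elt_of_surj y : exists x, elt_of x = y.
Proof.
case: y => [u|e].
  by have [h hK Kh] := pvert_bij p; exists (inl (h u)); rewrite /= Kh.
by have [i <-] := edge_of_surj e; exists (inr i).
Qed.

Lemma card_elt : #|G| + #|edge G| = #|pvertex p| + #|pedge p|.
Proof.
rewrite -!card_sum -(card_codom elt_of_inj); apply: esym; apply: eq_card => y.
by apply/codomP; have [x <-] := elt_of_surj y; exists x.
Qed.

(** * Transfer of weights and antimagic conditions to the presentation *)

Section Transfer.
Variables (f : labeling G) (g : pvertex p + pedge p -> nat).
Hypothesis fg : forall x, label f (elt_of x) = g x.

Lemma weight_elt_of x : weight f (elt_of x) = pweight g x.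
Proof.
case: x => [v|i] /=; last first.
  rewrite /eweight big_setU1 ?inE ?(inj_eq pvert_inj) ?src_neq_tgt //=.
  by rewrite big_set1 -!fg.
have -> : vweight f (pvert v) = \sum_(i in inc v) g (inr i).
  rewrite /vweight (reindex edge_of) /=; last first.
    apply: onW_bij; apply: inj_card_bij edge_of_inj _.
    rewrite -(card_codom edge_of_inj); apply: subset_leq_card.
    apply/subsetP=> e _; have [i <-] := edge_of_surj e; exact: codom_f.
  by apply: eq_big => [i|i _]; [rewrite -in_edge_of | rewrite -fg].
by rewrite big_uniq ?inc_uniq.
Qed.

Lemma nb_weights_pres : nb_weights f = nb_pweights g.
Proof.
apply/eqP; rewrite /nb_weights /nb_pweights -uniq_size_uniq ?undup_uniq //.
move=> w; rewrite !mem_undup; apply/codomP/codomP=> [] [].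
  by move=> x ->; exists (elt_of x); rewrite weight_elt_of.
by move=> y ->; have [x <-] := elt_of_surj y; exists x; rewrite weight_elt_of.
Qed.

Lemma antimagic_pres : local_total_antimagic f <-> antimagic g.
Proof.
have wv v : vweight f (pvert v) = pweight g (inl v).
  by rewrite -weight_elt_of.
have we i : eweight f (edge_of i) = pweight g (inr i).
  by rewrite -weight_elt_of.
have [h hK Kh] := pvert_bij p.
split=> [[f_bij fv fe fi]|[g_inj g_rng gv ge gi]]; split.
- by move=> x y; rewrite -!fg => -[/ord_inj/(bij_inj f_bij)/elt_of_inj].
- by move=> x; rewrite -fg -card_elt ltn_ord.
- by move=> i; rewrite -!wv; apply/fv/adj_src_tgt.
- move=> v i j vi vj ij; rewrite -!we; apply: fe; first by move/edge_of_inj.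
  by apply/set0Pn; exists (pvert v); rewrite inE !in_edge_of vi vj.
- by move=> v i vi; rewrite -we -wv; apply: fi; rewrite in_edge_of.
- apply: inj_card_bij; last by rewrite card_ord card_sum.
  move=> x' y'; have [x <-] := elt_of_surj x'; have [y <-] := elt_of_surj y'.
  by move=> e; congr elt_of; apply: g_inj; rewrite -!fg /label e.
- move=> u v; rewrite -(Kh u) -(Kh v) !wv => /adj_pedge[i].
  by have := gv i => /[swap] -[] [-> ->] // ne /esym.
- move=> e1 e2; have [i <-] := edge_of_surj e1; have [j <-] := edge_of_surj e2.
  move=> ij /set0Pn[u]; rewrite -(Kh u) inE !in_edge_of => /andP[ui uj].
  by rewrite !we; apply: ge ui uj _ => eij; apply: ij; rewrite eij.
- move=> u e; have [i <-] := edge_of_surj e.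
  by rewrite -(Kh u) in_edge_of wv we; apply: gi.
Qed.

End Transfer.

Lemma labeling_pres g : antimagic g ->
  exists f, forall x, label f (elt_of x) = g x.
Proof.
move=> g_anti; have [h hK Kh] : bijective elt_of.
  apply: inj_card_bij elt_of_inj _; rewrite !card_sum; apply: eq_leq.
  exact: card_elt.
have lt_g y : (g (h y)).-1 < #|G| + #|edge G|.
  by rewrite card_elt; have := antimagic_range g_anti (h y); lia.
exists (fun y => Ordinal (lt_g y)) => x; rewrite /label /= hK.
by have := antimagic_range g_anti x; lia.
Qed.

(** An upper bound for a single labeling is enough: the lower bound for all labelings turns it into
    an equality. *)
Lemma chi_lt_pres k :
    (exists2 g, antimagic g & nb_pweights g <= k) ->
    (forall g, antimagic g -> k <= nb_pweights g) ->
  chi_lt G k.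
Proof.
move=> [g g_anti le_k] ge_k; split; last first.
  move=> f f_anti; have E x : label f (elt_of x) = (label f \o elt_of) x by [].
  by rewrite (nb_weights_pres E); apply: ge_k; apply/(antimagic_pres E).
have [f fg] := labeling_pres g_anti; exists f; first exact/(antimagic_pres fg).
by apply/eqP; rewrite (nb_weights_pres fg) eqn_leq le_k ge_k.
Qed.

End Presentation.

(** * The graph mC_6 + nP_3 *)

Definition hexagons_paths (m n : nat) : sgraph :=
  dunion (copies m (cycle_graph 6)) (copies n (path_graph 3)).

Section HexagonsPaths.
Variables m n : nat.

Let V : finType := ('I_m * 'I_6 + 'I_n * 'I_3)%type.
Let E : finType := ('I_m * 'I_6 + 'I_n * 'I_2)%type.

Definition hp_src (x : E) : V :=
  match x with
  | inl (j, k) => inl (j, k)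
  | inr (j, i) => inr (j, widen_ord (leqnSn 2) i)
  end.

Definition hp_tgt (x : E) : V :=
  match x with
  | inl (j, k) => inl (j, ordS k)
  | inr (j, i) => inr (j, lift ord0 i)
  end.

Definition hp_inc (v : V) : seq E :=
  match v with
  | inl (j, k) => [:: inl (j, k); inl (j, ord_pred k)]
  | inr (j, k) =>
    match val k with
    | 0 => [:: inr (j, ord0)]
    | 1 => [:: inr (j, ord0); inr (j, ord_max)]
    | _ => [:: inr (j, ord_max)]
    end
  end.

Lemma ord2P (i : 'I_2) : i = ord0 \/ i = ord_max.
Proof. by case: i => -[|[|]] // H; [left|right]; apply: val_inj. Qed.

Lemma hp_adj_src_tgt x : @adj (hexagons_paths m n) (hp_src x) (hp_tgt x).
Proof.
case: x => [[j k]|[j i]]; rewrite /= /copies_adj /= eqxx /=.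
  by case: k => -[|[|[|[|[|[|]]]]]].
by case: (ord2P i) => ->.
Qed.

Lemma hp_adj_edge u v : @adj (hexagons_paths m n) u v ->
  exists x, (hp_src x = u /\ hp_tgt x = v) \/ (hp_src x = v /\ hp_tgt x = u).
Proof.
case: u v => [[j k]|[j k]] [[j' k']|[j' k']] //=; rewrite /copies_adj /=.
  move=> /andP[/eqP<- /andP[_ /orP[]/eqP<-]].
    by exists (inl (j, k)); left.
  by exists (inl (j, k')); right.
move=> /andP[/eqP<- /orP[]/eqP Dk].
  have lt_k : k < 2 by have := ltn_ord k'; lia.
  exists (inr (j, Ordinal lt_k)); left; rewrite /=.
  by split; congr (inr (_, _)); apply: val_inj.
have lt_k : k' < 2 by have := ltn_ord k; lia.
exists (inr (j, Ordinal lt_k)); right; rewrite /=.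
by split; congr (inr (_, _)); apply: val_inj.
Qed.

(** Opposite orientations would give [k = k' + 1] and [k' = k + 1], impossible modulo 6 and on a
    path. *)
Lemma hp_edge_inj x y : (hp_src x = hp_src y /\ hp_tgt x = hp_tgt y) \/
  (hp_src x = hp_tgt y /\ hp_tgt x = hp_src y) -> x = y.
Proof.
case: x y => [[j k]|[j i]] [[j' k']|[j' i']] //= [] [] //.
- by case=> -> ->.
- case=> -> -> [] /(congr1 val)/=; case: k' => /= l; lia.
- by case=> -> e _; congr (inr (_, _)); apply: val_inj.
- case=> -> e [] f; rewrite /bump /= in e f; lia.
Qed.

Lemma hp_inc_uniq v : uniq (hp_inc v).
Proof.
case: v => [[j k]|[j k]] /=; last first.
  case: k => -[|[|[|]]] // H.
  by rewrite /= inE (inj_eq inr_inj) xpair_eqE andbF.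
rewrite inE andbT; apply/eqP=> e; have := congr1 (fun x => val x.2) (inl_inj e).
by case: k {e} => -[|[|[|[|[|[|]]]]]].
Qed.

Lemma hp_mem_inc v x : (x \in hp_inc v) = (v == hp_src x) || (v == hp_tgt x).
Proof.
case: v x => [[j k]|[j k]] [[j' k']|[j' i]] //=; rewrite ?inE //.
- rewrite !(inj_eq inl_inj) !xpair_eqE (eq_sym j') (eq_sym k').
  by rewrite -(inj_eq (@ordS_inj 6)) ord_predK (eq_sym _ k) -andb_orr.
- by case: k => -[|[|[|]]] // H; rewrite !inE.
- case: k => -[|[|[|]]] // H;
  rewrite ?inE !(inj_eq inr_inj) !xpair_eqE (eq_sym j') -?andb_orr;
  by case: (ord2P i) => ->.
Qed.

Variables (G : sgraph) (pv : V -> G) (pv_bij : bijective pv).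
Hypothesis pv_adj :
  forall u v, adj (pv u) (pv v) = @adj (hexagons_paths m n) u v.

Lemma hp_pv_src_tgt x : adj (pv (hp_src x)) (pv (hp_tgt x)).
Proof. by rewrite pv_adj hp_adj_src_tgt. Qed.

Lemma hp_pv_edge u v : adj (pv u) (pv v) ->
  exists x, (hp_src x = u /\ hp_tgt x = v) \/ (hp_src x = v /\ hp_tgt x = u).
Proof. by rewrite pv_adj => /hp_adj_edge. Qed.

(** Stated along an isomorphism [pv] because one graph of the theorem contains the path itself
    instead of [copies 1] of it. *)
Definition hp_pres : presentation G := Presentation pv_bij hp_pv_src_tgt
  hp_pv_edge hp_edge_inj hp_inc_uniq hp_mem_inc.

Lemma hp_card : #|pvertex hp_pres| + #|pedge hp_pres| = 12 * m + 5 * n.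
Proof. rewrite /= !card_sum !card_prod !card_ord; lia. Qed.

End HexagonsPaths.

(** * Lower bounds *)

Lemma hexagon_three_weights (a b : nat) (v e : 'I_6 -> nat)
    (wv := fun k => e k + e (ord_pred k)) (we := fun k => v k + v (ordS k)) :
    (forall k, 0 < e k) ->
    (forall k, wv k \in [:: a; b; a + b]) ->
    (forall k, we k \in [:: a; b; a + b]) ->
    (forall k, wv k <> wv (ordS k)) -> (forall k, we k <> we (ordS k)) ->
    (forall k, wv k <> we k) -> (forall k, wv (ordS k) <> we k) ->
  False.
Proof.
move=> e_gt0 Wv We vv ee ve ve'.
(* In the sequence vertex, edge, vertex, edge, ... any three consecutive weights differ, so with
   three values it has period three; vertices [k] and [k + 2] are four places apart. *)
have wv2 k : wv (ordS (ordS k)) <> wv k.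
  have := We k; have := We (ordS k); have := Wv k; have := Wv (ordS k).
  have := vv k; have := ve k; have := ve' k; have := ee k.
  have := ve (ordS k); have := ve' (ordS k); rewrite !inE; lia.
(* Otherwise the two neighbours weigh [a] and [b], but their sum is the weight [a + b] of the middle
   vertex plus two positive outer edge labels. *)
have not_sum k : wv (ordS k) <> a + b.
  have := Wv k; have := Wv (ordS (ordS k)).
  have := vv k; have := vv (ordS k); have := wv2 k.
  have := e_gt0 (ord_pred k); have := e_gt0 (ordS (ordS k)).
  rewrite /wv !ordSK !inE; lia.
(* Vertices 1, 2, 3 have pairwise distinct weights, yet only [a] and [b] remain for them. *)
have := not_sum ord0; have := not_sum (ordS ord0).
have := not_sum (ordS (ordS ord0)).
have := Wv (ordS ord0); have := Wv (ordS (ordS ord0)).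
have := Wv (ordS (ordS (ordS ord0))).
have := vv (ordS ord0); have := vv (ordS (ordS ord0)); have := wv2 (ordS ord0).
rewrite !inE; lia.
Qed.

(** * Explicit weights in hexagons and paths, and counting bounds *)

Section Lower.
Variables (m n : nat) (G : sgraph) (pv : 'I_m * 'I_6 + 'I_n * 'I_3 -> G).
Hypotheses (pv_bij : bijective pv)
  (pv_adj : forall u v, adj (pv u) (pv v) = @adj (hexagons_paths m n) u v).
Let p := hp_pres pv_bij pv_adj.
Variable g : pvertex p + pedge p -> nat.

Definition hexv (j : 'I_m) (k : 'I_6) : pvertex p + pedge p := inl (inl (j, k)).
Definition hexe (j : 'I_m) (k : 'I_6) : pvertex p + pedge p := inr (inl (j, k)).
Definition pathv (j : 'I_n) (k : 'I_3) : pvertex p + pedge p :=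
  inl (inr (j, k)).
Definition pathe (j : 'I_n) (i : 'I_2) : pvertex p + pedge p :=
  inr (inr (j, i)).
(** This form is convertible to the target of the first edge of a path. *)
Definition mid : 'I_3 := lift ord0 ord0.

Lemma pweight_hexv j k :
  pweight g (hexv j k) = g (hexe j k) + g (hexe j (ord_pred k)).
Proof. by rewrite /= !big_cons big_nil addn0. Qed.

Lemma pweight_hexe j k :
  pweight g (hexe j k) = g (hexv j k) + g (hexv j (ordS k)).
Proof. by []. Qed.

Lemma pweight_pathv0 j : pweight g (pathv j ord0) = g (pathe j ord0).
Proof. exact: big_seq1. Qed.

Lemma pweight_pathv1 j :
  pweight g (pathv j mid) = g (pathe j ord0) + g (pathe j ord_max).
Proof. by rewrite /= !big_cons big_nil addn0. Qed.

Lemma pweight_pathv2 j : pweight g (pathv j ord_max) = g (pathe j ord_max).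
Proof. exact: big_seq1. Qed.

Lemma pweight_pathe0 j :
  pweight g (pathe j ord0) = g (pathv j ord0) + g (pathv j mid).
Proof. by congr (g (inl (inr (_, _))) + _); apply: val_inj. Qed.

Lemma pweight_pathe1 j :
  pweight g (pathe j ord_max) = g (pathv j mid) + g (pathv j ord_max).
Proof.
by congr (g (inl (inr (_, _))) + g (inl (inr (_, _)))); apply: val_inj.
Qed.

Definition pendants : seq nat :=
  [seq g (pathe x.1 x.2) | x <- enum {: 'I_n * 'I_2}].

Lemma size_pendants : size pendants = 2 * n.
Proof. by rewrite size_map -cardE card_prod !card_ord mulnC. Qed.

Lemma mem_pendants j i : g (pathe j i) \in pendants.
Proof. by apply/mapP; exists (j, i); rewrite ?mem_enum. Qed.

Lemma nb_pweights_ge (s : seq nat) : uniq s ->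
  {subset s <= codom (pweight g)} -> size s <= nb_pweights g.
Proof.
by move=> us sub; apply: uniq_leq_size us _ => w /sub; rewrite mem_undup.
Qed.

Lemma nb_pweights_le (s : seq nat) :
  (forall x, pweight g x \in s) -> nb_pweights g <= size s.
Proof.
move=> sub; apply: uniq_leq_size (undup_uniq _) _ => w.
by rewrite mem_undup => /codomP[x ->].
Qed.

Hypothesis g_anti : antimagic g.

Lemma uniq_pendants : uniq pendants.
Proof.
rewrite map_inj_uniq ?enum_uniq // => -[j i] [j' i'].
by move=> e; apply: inr_inj (inr_inj (antimagic_inj g_anti e)).
Qed.

(** An end of a path lies on one edge only and takes the label of that edge as its weight. *)
Lemma pendants_codom : {subset pendants <= codom (pweight g)}.
Proof.
move=> w /mapP[[j i] _ ->]; case: (ord2P i) => ->.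
  by rewrite -pweight_pathv0 codom_f.
by rewrite -pweight_pathv2 codom_f.
Qed.

Lemma g_gt0 x : 0 < g x.
Proof. by have /andP[] := antimagic_range g_anti x. Qed.

Lemma nb_pweights_ge_pendants : 0 < n -> 2 * n + 1 <= nb_pweights g.
Proof.
move=> n_gt0.
pose F (x : 'I_n * 'I_2) := g (pathe x.1 x.2).
(* Whichever edge of path [j] carries the maximal label, adding the other label at the centre
   exceeds it. *)
have [[j i] _ max_ji] := @arg_maxnP _ (Ordinal n_gt0, ord0) xpredT F isT.
rewrite addn1 -size_pendants.
apply: (@nb_pweights_ge (pweight g (pathv j mid) :: pendants)) => [|w].
  rewrite cons_uniq uniq_pendants andbT; apply/negP=> /mapP[x _].
  rewrite pweight_pathv1; have := max_ji x isT; rewrite /F /=.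
  have := g_gt0 (pathe j ord0); have := g_gt0 (pathe j ord_max).
  by case: (ord2P i) => ->; lia.
by rewrite inE => /predU1P[->|/pendants_codom //]; apply: codom_f.
Qed.

Lemma nb_pweights_gt3 : 0 < m -> n = 1 -> 3 < nb_pweights g.
Proof.
move=> m_gt0 n1; rewrite ltnNge; apply/negP=> le3.
have j : 'I_n by rewrite n1; exact: ord0.
pose a := g (pathe j ord0); pose b := g (pathe j ord_max).
have [a0 b0] : 0 < a /\ 0 < b by split; apply: g_gt0.
have ab : a <> b.
  by move=> e; have := inr_inj (inr_inj (antimagic_inj g_anti e)).
have us : uniq [:: a; b; a + b] by rewrite /= !inE; lia.
have sub : {subset [:: a; b; a + b] <= undup (codom (pweight g))}.
  move=> w; rewrite mem_undup !inE => /or3P[]/eqP->.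
  - by rewrite /a -pweight_pathv0 codom_f.
  - by rewrite /b -pweight_pathv2 codom_f.
  - by rewrite -pweight_pathv1 codom_f.
(* Three distinct weights among at most three are all the weights. *)
have [_ colors] := uniq_min_size us sub le3.
have W x : pweight g x \in [:: a; b; a + b].
  by rewrite colors mem_undup codom_f.
pose h : 'I_m := Ordinal m_gt0.
have inc0 k : inl (h, k) \in @inc G p (inl (h, k)) by rewrite inE eqxx.
have inc1 k : inl (h, k) \in @inc G p (inl (h, ordS k)).
  by rewrite !inE ordSK eqxx orbT.
apply: (@hexagon_three_weights a b (fun k => g (hexv h k))
  (fun k => g (hexe h k))).
- by move=> k; apply: g_gt0.
- by move=> k; rewrite -pweight_hexv.
- by move=> k; rewrite -pweight_hexe.
- move=> k; rewrite -!pweight_hexv.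
  exact: (antimagic_vertices g_anti (i := inl (h, k))).
- move=> k; rewrite -!pweight_hexe.
  apply: (antimagic_edges g_anti (inc1 k) (inc0 (ordS k))).
  move=> e; have := congr1 (fun x => val x.2) (inl_inj e).
  by case: k {e} => -[|[|[|[|[|[|]]]]]].
- move=> k; rewrite -pweight_hexv -pweight_hexe.
  exact: (antimagic_incident g_anti).
- move=> k; rewrite -pweight_hexv -pweight_hexe.
  exact: (antimagic_incident g_anti).
Qed.

End Lower.

(** * Construction *)

Section Upper.
Variables (m n : nat) (n_gt0 : 0 < n).

(** These are s, A, B of the construction. As A = 2s, the values y, A-y, B-y for 0 < y < s fill the
    intervals 1..s-1, s+1..A-1 and 8m+4n..B-1; the gaps s, A..8m+4n-1 (empty if n = 1) and B are
    left for the pendant edges. *)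
Let sg := 4 * m + n + 1.
Let al := 8 * m + 2 * n + 2.
Let be := 12 * m + 5 * n.

(** Entries 0 and 3 are the orbit t, s-t. Cyclically, each is followed by its complement to A and
    preceded by its complement to B; the two other sums are then A+B-s. *)
Definition hex_label (t k : nat) : nat :=
  nth 0 [:: t; al - t; be - sg + t; sg - t; al - sg + t; be - t] k.

Definition pathv_label (j k : nat) : nat :=
  let y := 2 * m + 1 + j in nth 0 [:: al - y; y; be - y] k.

(** The larger label comes first. The first edge of a path has weight A and the second weight B, so
    this keeps the labels A and B, which become weights of end vertices, off the edges of equal
    weight. *)
Definition pathe_label (j i : nat) : nat :=
  nth 0 (if j is 0 then [:: be; sg]
         else [:: 8 * m + 4 * n - j; 8 * m + 2 * n + 1 + j]) i.

(* In a hexagon the vertex labels are read with a shift by one, so that edge k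
   gets the weight that vertices k-1 and k+2 have, not that of its ends. *)
Definition hp_label
    (x : ('I_m * 'I_6 + 'I_n * 'I_3) + ('I_m * 'I_6 + 'I_n * 'I_2)) : nat :=
  match x with
  | inl (inl (j, k)) => hex_label (m + j.+1) (ordS k)
  | inl (inr (j, k)) => pathv_label j k
  | inr (inl (j, k)) => hex_label j.+1 k
  | inr (inr (j, i)) => pathe_label j i
  end.

(** For t at most 2m the value s-t exceeds 2m+n, so distinct t have disjoint orbits, all avoiding
    the middle values 2m+1..2m+n of the paths. *)
Lemma hex_label_inj t t' k k' : 0 < t <= 2 * m -> 0 < t' <= 2 * m ->
  k < 6 -> k' < 6 -> hex_label t k = hex_label t' k' -> t = t' /\ k = k'.
Proof.
move: k k' => [|[|[|[|[|[|k]]]]]] [|[|[|[|[|[|k']]]]]] // ht ht' _ _;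
rewrite /hex_label /nth /sg /al /be; lia.
Qed.

Lemma hex_label_range t k : 0 < t <= 2 * m -> k < 6 ->
  0 < hex_label t k <= 12 * m + 5 * n.
Proof.
move: k => [|[|[|[|[|[|k]]]]]] // ht _;
rewrite /hex_label /nth /sg /al /be; lia.
Qed.

Lemma hex_path t k j i : 0 < t <= 2 * m -> j < n -> k < 6 -> i < 3 ->
  hex_label t k <> pathv_label j i.
Proof.
move: k i => [|[|[|[|[|[|k]]]]]] [|[|[|i]]] // ht hj _ _;
rewrite /hex_label /pathv_label /nth /sg /al /be; lia.
Qed.

Lemma hex_pathe t k j i : 0 < t <= 2 * m -> j < n -> k < 6 -> i < 2 ->
  hex_label t k <> pathe_label j i.
Proof.
move: k i j => [|[|[|[|[|[|k]]]]]] [|[|i]] // [|j] // ht hj _ _;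
rewrite /hex_label /pathe_label /nth /sg /al /be; lia.
Qed.

Lemma pathv_pathe k j i j' : j < n -> j' < n -> k < 3 -> i < 2 ->
  pathv_label j k <> pathe_label j' i.
Proof.
move: k i j' => [|[|[|k]]] [|[|i]] // [|j'] // hj hj' _ _;
rewrite /pathv_label /pathe_label /nth /sg /al /be; lia.
Qed.

Lemma pathv_label_inj j j' k k' : j < n -> j' < n -> k < 3 -> k' < 3 ->
  pathv_label j k = pathv_label j' k' -> j = j' /\ k = k'.
Proof.
move: k k' => [|[|[|k]]] [|[|[|k']]] // hj hj' _ _;
rewrite /pathv_label /nth /sg /al /be; lia.
Qed.

Lemma pathe_label_inj j j' k k' : j < n -> j' < n -> k < 2 -> k' < 2 ->
  pathe_label j k = pathe_label j' k' -> j = j' /\ k = k'.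
Proof.
move: k k' j j' => [|[|k]] [|[|k']] // [|j] [|j'] // hj hj' _ _;
rewrite /pathe_label /nth /sg /al /be; lia.
Qed.

Lemma hp_label_inj : injective hp_label.
Proof.
have t1 (j : 'I_m) : 0 < j.+1 <= 2 * m by have := ltn_ord j; lia.
have t2 (j : 'I_m) : 0 < m + j.+1 <= 2 * m by have := ltn_ord j; lia.
have lt6 (k : 'I_6) : k.+1 %% 6 < 6 by rewrite ltn_mod.
case=> [[[j k]|[j k]]|[[j k]|[j k]]] [[[j' k']|[j' k']]|[[j' k']|[j' k']]] /=.
- move/hex_label_inj => [] // e e'.
  congr (inl (inl (_, _))); first by apply: ord_inj; lia.
  by apply: ordS_inj; apply: ord_inj.
- by move/hex_path=> [] //.
(* Hexagon vertices use the parameters m+1..2m, hexagon edges 1..m. *)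
- move/hex_label_inj=> [] //; have := ltn_ord j'; lia.
- by move/hex_pathe=> [] //.
- by move/esym/hex_path=> [] //.
- by move/pathv_label_inj=> [] // /ord_inj-> /ord_inj->.
- by move/esym/hex_path=> [] //.
- by move/pathv_pathe=> [] //.
- move/hex_label_inj=> [] //; have := ltn_ord j; lia.
- by move/hex_path=> [] //.
- by move/hex_label_inj => [] // [/ord_inj->] /ord_inj->.
- by move/hex_pathe=> [] //.
- by move/esym/hex_pathe=> [] //.
- by move/esym/pathv_pathe=> [] //.
- by move/esym/hex_pathe=> [] //.
- by move/pathe_label_inj=> [] // /ord_inj-> /ord_inj->.
Qed.

Lemma hp_label_range x : 0 < hp_label x <= 12 * m + 5 * n.
Proof.
case: x => [[[j k]|[j k]]|[[j k]|[j k]]] /=; have := ltn_ord j.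
- by move=> lt_j; apply: hex_label_range; rewrite ?ltn_mod; lia.
- by case: k => -[|[|[|?]]] //=; rewrite /pathv_label /nth /sg /al /be; lia.
- by move=> lt_j; apply: hex_label_range => //; lia.
- by case: j k => -[|j] ? [[|[|?]]] //=;
    rewrite /pathe_label /nth /sg /al /be; lia.
Qed.

Definition hex_color (k : nat) : nat :=
  nth 0 [:: be; al; al + be - sg] (k %% 3).

Lemma hex_label_sum t (k : 'I_6) : 0 < t <= 2 * m ->
  hex_label t k + hex_label t (ord_pred k) = hex_color k.
Proof.
case: k => -[|[|[|[|[|[|?]]]]]] //= H ht;
by rewrite /hex_label /hex_color /= /sg /al /be; lia.
Qed.

(** A < B since n > 0, and B < A+B-s since s < A. *)
Lemma hex_color_inj k k' : hex_color k = hex_color k' -> k = k' %[mod 3].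
Proof.
rewrite /hex_color; have := ltn_pmod k (isT : 0 < 3).
have := ltn_pmod k' (isT : 0 < 3).
move: (k %% 3) (k' %% 3) => [|[|[|i]]] [|[|[|i']]] //=;
rewrite /sg /al /be; lia.
Qed.


(** * Weights of the constructed labeling *)

Variables (G : sgraph) (pv : 'I_m * 'I_6 + 'I_n * 'I_3 -> G).
Hypotheses (pv_bij : bijective pv)
  (pv_adj : forall u v, adj (pv u) (pv v) = @adj (hexagons_paths m n) u v).
Let p := hp_pres pv_bij pv_adj.
Let g : pvertex p + pedge p -> nat := hp_label.

Lemma hp_pweight_hexv j k :
  pweight g (hexv pv_bij pv_adj j k) = hex_color k.
Proof.
by rewrite pweight_hexv [LHS]/= hex_label_sum //; have := ltn_ord j; lia.
Qed.

Lemma hp_pweight_hexe j k :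
  pweight g (hexe pv_bij pv_adj j k) = hex_color (ordS (ordS k)).
Proof.
rewrite pweight_hexe -(@hex_label_sum (m + j.+1)).
  by rewrite ordSK addnC.
by have := ltn_ord j; lia.
Qed.

Lemma hp_pweight_mid j : pweight g (pathv pv_bij pv_adj j mid) = al + be - sg.
Proof.
rewrite pweight_pathv1 /= /sg /al /be; case: j => -[|j] lt_j;
rewrite /pathe_label /nth /=; lia.
Qed.

Lemma hp_pweight_pathe0 j : pweight g (pathe pv_bij pv_adj j ord0) = al.
Proof.
rewrite pweight_pathe0 /= /pathv_label /= /al; have := ltn_ord j; lia.
Qed.

Lemma hp_pweight_pathe1 j : pweight g (pathe pv_bij pv_adj j ord_max) = be.
Proof.
rewrite pweight_pathe1 /= /pathv_label /= /be; have := ltn_ord j; lia.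
Qed.

Lemma hp_pathe0_neq (j : 'I_n) : pathe_label j 0 <> al.
Proof.
by case: j => -[|j] lt_j; rewrite /pathe_label /= /al /be /sg; lia.
Qed.

Lemma hp_pathe1_neq (j : 'I_n) : pathe_label j 1 <> be.
Proof.
by case: j => -[|j] lt_j; rewrite /pathe_label /= /al /be /sg; lia.
Qed.

Lemma hp_antimagic : antimagic g.
Proof.
have al_be : al <> be by rewrite /al /be; lia.
have [W_al W_be] : al + be - sg <> al /\ al + be - sg <> be.
  by rewrite /al /be /sg; split; lia.
have neq_add a b : 0 < a -> 0 < b -> a <> a + b /\ a + b <> b by split; lia.
have label_gt0 x : 0 < g x by case/andP: (hp_label_range x).
split.
- exact: hp_label_inj.
- move=> x; rewrite hp_card; exact: hp_label_range.
- case=> [[j k]|[j i]].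
    have -> : pweight g (inl (src (p := p) (inl (j, k)))) = hex_color k.
      exact: hp_pweight_hexv.
    have -> : pweight g (inl (tgt (p := p) (inl (j, k)))) = hex_color (ordS k).
      exact: hp_pweight_hexv.
    by move/hex_color_inj => /=; have := ltn_ord k; lia.
  have a0 := label_gt0 (inr (inr (j, ord0))).
  have b0 := label_gt0 (inr (inr (j, ord_max))).
  case: (ord2P i) => ->.
    have -> : src (p := p) (inr (j, ord0)) = inr (j, ord0).
      by congr (inr (_, _)); apply: val_inj.
    have -> : tgt (p := p) (inr (j, ord0)) = inr (j, mid) by [].
    have := pweight_pathv1 g j; have := pweight_pathv0 g j.
    by rewrite /pathv /pathe => -> ->; apply: (neq_add _ _ a0 b0).1.
  have -> : src (p := p) (inr (j, ord_max)) = inr (j, mid).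
    by congr (inr (_, _)); apply: val_inj.
  have -> : tgt (p := p) (inr (j, ord_max)) = inr (j, ord_max).
    by congr (inr (_, _)); apply: val_inj.
  have := pweight_pathv1 g j; have := pweight_pathv2 g j.
  by rewrite /pathv /pathe => -> ->; apply: (neq_add _ _ a0 b0).2.
(* At vertex [k], of colour [k], the edges [k] and [k - 1] have colours [k + 2] and [k + 1]: all
   three residues modulo 3 occur. *)
- have E j k : pweight g (inr (inl (j, k))) = hex_color (ordS (ordS k)).
    exact: hp_pweight_hexe.
  case=> [[j k]|[j [[|[|[|k]]] // lt_k]]] x y; rewrite !inE.
  + by do 2![case/orP => /eqP->];
      rewrite // !E ?ord_predK => ne /hex_color_inj /=; have := ltn_ord k; lia.
  + by move=> /eqP-> /eqP->.
  + by do 2![case/orP => /eqP->] => // _;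
      rewrite hp_pweight_pathe0 hp_pweight_pathe1; auto.
  + by move=> /eqP-> /eqP->.
- case=> [[j k]|[j [[|[|[|k]]] // lt_k]]] x; rewrite !inE.
  + case/orP => /eqP->; rewrite hp_pweight_hexv hp_pweight_hexe;
    move/hex_color_inj => /=; have := ltn_ord k; lia.
  + move/eqP=> ->.
    have -> : Ordinal lt_k = ord0 by apply: val_inj.
    by rewrite pweight_pathv0 hp_pweight_pathe0; apply: hp_pathe0_neq.
  + have -> : Ordinal lt_k = mid by apply: val_inj.
    by case/orP=> /eqP->;
      rewrite hp_pweight_mid ?hp_pweight_pathe0 ?hp_pweight_pathe1.
  + move/eqP=> ->.
    have -> : Ordinal lt_k = ord_max by apply: val_inj.
    by rewrite pweight_pathv2 hp_pweight_pathe1; apply: hp_pathe1_neq.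
Qed.

(** Hexagons, path edges and path centres only use A, B, A+B-s; the ends of the paths contribute the
    pendant labels. *)
Lemma hp_pweight_mem (s : seq nat) :
    al \in s -> be \in s -> al + be - sg \in s ->
    (forall j i, g (pathe pv_bij pv_adj j i) \in s) ->
  forall x, pweight g x \in s.
Proof.
move=> s_al s_be s_W s_pend.
have s_color k : hex_color k \in s.
  rewrite /hex_color; have := ltn_pmod k (isT : 0 < 3).
  by case: (k %% 3) => [|[|[|]]].
case=> [[[j k]|[j [[|[|[|k]]] // lt_k]]]|[[j k]|[j i]]].
- by rewrite hp_pweight_hexv.
- have -> : Ordinal lt_k = ord0 by apply: val_inj.
  by rewrite pweight_pathv0.
- have -> : Ordinal lt_k = mid by apply: val_inj.
  by rewrite hp_pweight_mid.
- have -> : Ordinal lt_k = ord_max by apply: val_inj.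
  by rewrite pweight_pathv2.
- by rewrite hp_pweight_hexe.
- by case: (ord2P i) => ->; rewrite ?hp_pweight_pathe0 ?hp_pweight_pathe1.
Qed.

Let pend_be : be \in pendants g.
Proof. exact: (mem_pendants g (Ordinal n_gt0) ord0). Qed.

Lemma hp_nb_pweights1 : n = 1 -> nb_pweights g <= 4.
Proof.
move=> n1; pose s := [:: al, al + be - sg & pendants g].
apply: leq_trans (nb_pweights_le (s := s) _) _.
  apply: hp_pweight_mem; rewrite ?inE ?eqxx ?orbT //.
    by rewrite pend_be !orbT.
  by move=> j i; rewrite !inE mem_pendants !orbT.
by rewrite /= size_pendants n1.
Qed.

Lemma hp_nb_pweights : 1 < n -> nb_pweights g <= 2 * n + 1.
Proof.
move=> n2; pose s := (al + be - sg) :: pendants g.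
apply: leq_trans (nb_pweights_le (s := s) _) _.
  apply: hp_pweight_mem; rewrite ?inE ?eqxx ?orbT //; last 2 first.
  - by rewrite pend_be orbT.
  - by move=> j i; rewrite inE mem_pendants orbT.
  (* Path 1 exists since n > 1, and its second edge has label 8m+2n+2 = A, so A is no extra
     weight. *)
  have <- : g (pathe pv_bij pv_adj (Ordinal n2) ord_max) = al.
    by rewrite /= /pathe_label /= /al; lia.
  by rewrite mem_pendants orbT.
by rewrite /= size_pendants addn1.
Qed.

End Upper.

Theorem theorem4p2 (m n : nat) (hm : 1 <= m) (hn : 2 <= n) :
  chi_lt (dunion (copies m (cycle_graph 6)) (path_graph 3)) 4 /\
  chi_lt (dunion (copies m (cycle_graph 6)) (copies n (path_graph 3)))
    (2 * n + 1).
Proof.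
split.
  (* The isomorphism forgets the index of the only path. *)
  pose pv (u : 'I_m * 'I_6 + 'I_1 * 'I_3) :
    dunion (copies m (cycle_graph 6)) (path_graph 3) :=
    match u with inl x => inl x | inr x => inr x.2 end.
  have pv_bij : bijective pv.
    exists (fun y => match y with inl x => inl x | inr k => inr (ord0, k) end).
      by case=> // -[j k] /=; rewrite [j]ord1.
    by case.
  have pv_adj u v : adj (pv u) (pv v) = @adj (hexagons_paths m 1) u v.
    case: u v => [?|[j k]] [?|[j' k']] //=.
    by rewrite /copies_adj /= [j]ord1 [j']ord1.
  apply: (@chi_lt_pres _ (hp_pres pv_bij pv_adj)).
    by exists (@hp_label m 1); [exact: hp_antimagic | exact: hp_nb_pweights1].
  by move=> g g_anti; apply: nb_pweights_gt3.
have id_bij : bijective (@id (hexagons_paths m n)) by exists id.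
have n_gt0 : 0 < n by apply: ltnW.
apply: (@chi_lt_pres _ (hp_pres id_bij (fun _ _ => erefl))).
  by exists (@hp_label m n); [exact: hp_antimagic | exact: hp_nb_pweights].
by move=> g g_anti; apply: nb_pweights_ge_pendants.
Qed.
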